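(* In the setting described in the context, given the functions $\{g[u_k](x_j,\cdot)\}_{1\le k\le n_0,1\le j\le J}$, let $$\xi_{kj}(s)=\mathcal{L}_{\overline{G}}\Big[\frac{g[u_k](x_j,\cdot)}{\dot\rho(\cdot)}\Big](s)=\int_{\mathcal{S}}\overline{G}(s,s')\,g[u_k](x_j,s')\,ds'$$ for each $k,j$. Then $\xi_{kj}\in H_{\overline{G}}$ and $\langle\xi_{kj},\phi\rangle_{H_{\overline{G}}}=R_\phi[u_k](x_j)$ for every $\phi\in H_{\overline{G}}$. Let $$\boldsymbol{\Sigma}=\big(\langle\xi_{kj},\xi_{k'j'}\rangle_{H_{\overline{G}}}\big)\in\mathbb{R}^{n_0J\times n_0J},\qquad \mathbf{f}=(f_k(x_j))\in\mathbb{R}^{n_0J}.$$ Then the following finite-dimensional representations hold. (a) The least squares estimator with minimal $H_{\overline{G}}$-norm is $$\widetilde\phi=\operatorname*{arg\,min}_{\psi\in\operatorname*{arg\,min}_{\phi\in H_{\overline{G}}}\mathcal{E}_{\mathcal{D}}(\phi)}\|\psi\|_{H_{\overline{G}}}^2=\sum_{k,j}\widetilde c_{kj}\,\xi_{kj},\qquad (\widetilde c_{kj})=:\widetilde{\mathbf{c}}=\boldsymbol{\Sigma}^{\dagger}\mathbf{f},$$ where $\widetilde{\mathbf{c}}$ is the minimal 2-norm solution of $\min_{\mathbf{c}}\frac1{n_0J}\|\boldsymbol{\Sigma}\mathbf{c}-\mathbf{f}\|_2^2$. (b) The estimator of Tikhonov regularization with $H_{\overline{G}}$-norm and $\lambda>0$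 is $$\widehat\phi_\lambda=\operatorname*{arg\,min}_{\phi\in H_{\overline{G}}}\mathcal{E}_\lambda(\phi)=\sum_{k,j}\widehat c_{kj}\,\xi_{kj},\qquad \widehat{\mathbf{c}}_\lambda=(\boldsymbol{\Sigma}^2+n_0J\lambda\boldsymbol{\Sigma})^{\dagger}\boldsymbol{\Sigma}\mathbf{f},$$ where the coefficient $\widehat{\mathbf{c}}_\lambda=(\widehat c_{kj})\in\mathbb{R}^{n_0J}$ solves $\min_{\mathbf{c}}\{\frac1{n_0J}\|\boldsymbol{\Sigma}\mathbf{c}-\mathbf{f}\|_2^2+\lambda\,\mathbf{c}^\top\boldsymbol{\Sigma}\mathbf{c}\}$.
   Context: Setting. $\mathcal{S}=[0,1]$ with Lebesgue measure; $\mathcal{X}=\{x_j\}_{j=1}^J\subset[0,1]$ is a uniform mesh with mesh size $\Delta x=1/J$, equipped with the atomic measure $\nu(\{x_j\})=1/J$. For given inputs $u_1,\dots,u_{n_0}$ the real-valued functions $g[u_k](x,s)$, $(x,s)\in\mathcal{X}\times\mathcal{S}$, lie in $L^2(\mathcal{X}\times\mathcal{S})$ and are uniformly bounded: $\max_k\sup_{x\in\mathcal{X},s\in\mathcal{S}}|g[u_k](x,s)|<\infty$. For a kernel $\phi$, $R_\phi[u_k](x)=\int_{\mathcal{S}}\phi(s)\,g[u_k](x,s)\,ds$ for $x\in\mathcal{X}$. The output data are real numbers $f_k(x_j)$. The loss functions are $$\mathcal{E}_{\mathcal{D}}(\phi)=\frac1{n_0}\sum_{k=1}^{n_0}\sum_{j=1}^{J}|R_\phi[u_k](x_j)-f_k(x_j)|^2\,\Delta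 x,\qquad \mathcal{E}_\lambda(\phi)=\mathcal{E}_{\mathcal{D}}(\phi)+\lambda\|\phi\|_{H_{\overline{G}}}^2 .$$ Exploration measure. $\rho$ is the measure on $\mathcal{S}$ with Lebesgue density $\dot\rho(s)=\frac{1}{n_0Z}\sum_{k=1}^{n_0}\int_{\mathcal{X}}|g[u_k](x,s)|\,\nu(dx)$, where $Z=\frac1{n_0}\sum_{k=1}^{n_0}\int_{\mathcal{S}}\int_{\mathcal{X}}|g[u_k](x,s)|\,\nu(dx)\,ds$ (assumed positive). Quotients $g[u_k](x_j,s)/\dot\rho(s)$ are taken to be $0$ where $\dot\rho(s)=0$ (there $g[u_k](x_j,s)=0$ too). $L^2_\rho=L^2_\rho(\mathcal{S})$. Automatic reproducing kernel and its RKHS. $$G(s,s')=\frac1{n_0}\sum_{k=1}^{n_0}\int_{\mathcal{X}}g[u_k](x,s)g[u_k](x,s')\,\nu(dx),\qquad \overline{G}(s,s')=\frac{G(s,s')}{\dot\rho(s)\dot\rho(s')}\mathbf{1}_{\{\dot\rho(s)\dot\rho(s')>0\}}.$$ The operator $\mathcal{L}_{\overline{G}}:L^2_\rho\to L^2_\rho$, $\mathcal{L}_{\overline{G}}\phi(s)=\int_{\mathcal{S}}\phi(s')\overline{G}(s,s')\rho(ds')$, is compact, self-adjoint and positive semidefinite. $H_{\overline{G}}=\mathcal{L}_{\overline{G}}^{1/2}(L^2_\rho)$ is the RKHS of $\overline{G}$ with inner product $\langle\phi,\psi\rangle_{H_{\overline{G}}}=\langle\mathcal{L}_{\overline{G}}^{-1/2}\phi,\mathcal{L}_{\overline{G}}^{-1/2}\psi\rangle_{L^2_\rho}$,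 where $\mathcal{L}_{\overline{G}}^{-1/2}$ is the inverse of $\mathcal{L}_{\overline{G}}^{1/2}$ restricted to $\mathcal{N}(\mathcal{L}_{\overline{G}})^\perp$ (orthogonal complement in $L^2_\rho$ of the null space). Conventions. $\dagger$ denotes the Moore–Penrose pseudoinverse; vectors in $\mathbb{R}^{n_0J}$ and rows/columns of $\boldsymbol{\Sigma}$ are indexed by pairs $(k,j)$, $1\le k\le n_0$, $1\le j\le J$. *)

(* Defs.v *)
From HB Require Import structures.
From mathcomp Require Import all_boot all_order all_algebra.
From mathcomp Require Import all_classical all_reals all_analysis.
Set Implicit Arguments.
Unset Strict Implicit.
Unset Printing Implicit Defensive.
Import Order.TTheory GRing.Theory Num.Theory.
Import numFieldNormedType.Exports.
Local Open Scope classical_set_scope.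
Local Open Scope ring_scope.

Definition argmin (T : Type) (R : realType) (D : set T) (F : T -> R) : set T :=
  [set a | D a /\ forall b, D b -> F a <= F b].

Section Matrices.
Context {R : realType}.

Definition is_pseudoinverse m n (A : 'M[R]_(m, n)) (P : 'M[R]_(n, m)) : Prop :=
  [/\ A *m P *m A = A, P *m A *m P = P,
      (A *m P)^T = A *m P & (P *m A)^T = P *m A].

(* The conditions above determine P.  This is not [pinvmx], which is only some
   generalized inverse of A. *)
Definition pseudoinverse m n (A : 'M[R]_(m, n)) : 'M[R]_(n, m) :=
  xget 0 [set P | is_pseudoinverse A P].

(* The norm [`|v|] of the library is the sup norm on matrices. *)
Definition norm2sq n (v : 'cV[R]_n) : R := \sum_(i < n) v i 0 ^+ 2.

(* Inverse of [mxvec_index]: it lists 'I_n0 * 'I_J by 'I_(n0 * J). *)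
Definition pair_of_index n0 J (p : 'I_(n0 * J)) : 'I_n0 * 'I_J :=
  enum_val (cast_ord (esym (mxvec_cast n0 J)) p).

End Matrices.

(* A function on a set S of reals is a function R -> R of which only the values
   on S matter; an element of L^2_mu(S) is such a function up to
   [ae_eq mu S]. *)
Section L2.
Context {R : realType}.
Variables (mu : {measure set (measurableTypeR R) -> \bar R}) (S : set R).
Implicit Types (phi psi : R -> R) (A B : (R -> R) -> (R -> R)).

Definition in_L2 phi : Prop :=
  measurable_fun S phi /\ mu.-integrable S (fun s => (phi s ^+ 2)%:E).

Definition L2_dot phi psi : R := \int[mu]_(s in S) (phi s * psi s).

Definition L2_linear_operator B : Prop :=
  [/\ forall phi, in_L2 phi -> in_L2 (B phi),
      forall phi psi, in_L2 phi -> in_L2 psi ->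
        ae_eq mu S phi psi -> ae_eq mu S (B phi) (B psi)
    & forall (a : R) phi psi, in_L2 phi -> in_L2 psi ->
        ae_eq mu S (B (fun s => a * phi s + psi s))
                   (fun s => a * B phi s + B psi s)].

Definition L2_self_adjoint B : Prop :=
  forall phi psi, in_L2 phi -> in_L2 psi ->
    L2_dot (B phi) psi = L2_dot phi (B psi).

Definition L2_positive B : Prop :=
  forall phi, in_L2 phi -> 0 <= L2_dot (B phi) phi.

(* An everywhere defined self-adjoint operator is bounded, so this is the usual
   notion of positive square root. *)
Definition is_sqrt_operator A B : Prop :=
  [/\ L2_linear_operator B, L2_self_adjoint B, L2_positive B
    & forall phi, in_L2 phi -> ae_eq mu S (B (B phi)) (A phi)].

(* Unique up to [ae_eq] when A is bounded, self-adjoint and positive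
   semidefinite. *)
Definition sqrt_operator A : (R -> R) -> (R -> R) :=
  xget (id : (R -> R) -> (R -> R)) [set B | is_sqrt_operator A B].

Definition L2_null A phi : Prop := in_L2 phi /\ ae_eq mu S (A phi) (cst 0).

Definition L2_null_orth A psi : Prop :=
  in_L2 psi /\ forall eta, L2_null A eta -> L2_dot psi eta = 0.

(* A^{-1/2}: the inverse of A^{1/2} restricted to the orthogonal complement of
   the null space of A. *)
Definition inv_sqrt_operator A phi : R -> R :=
  xget (cst 0 : R -> R)
    [set psi | L2_null_orth A psi /\ ae_eq mu S (sqrt_operator A psi) phi].

(* The space A^{1/2}(L^2_mu(S)) and its inner product. *)
Definition in_range_sqrt A phi : Prop :=
  in_L2 phi /\ exists2 psi, in_L2 psi & ae_eq mu S phi (sqrt_operator A psi).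

Definition range_sqrt_dot A phi psi : R :=
  L2_dot (inv_sqrt_operator A phi) (inv_sqrt_operator A psi).

(* F attains its minimum on D at phi0, and nowhere else in L^2_mu(S). *)
Definition unique_argmin (D : set (R -> R)) (F : (R -> R) -> R) phi0 : Prop :=
  argmin D F phi0 /\ forall phi, argmin D F phi -> ae_eq mu S phi phi0.

End L2.

Section Setting.
Context {R : realType}.

Definition leb : {measure set (measurableTypeR R) -> \bar R} :=
  @lebesgue_measure R.

Definition S01 : set R := `[0, 1]%classic.

(* Mesh points are x 0, ..., x J.-1. *)
Variables (n0 J : nat) (x : nat -> R).

Definition mesh : set R := [set x j | j in `I_J].

Definition uniform_mesh : Prop :=
  mesh `<=` S01 /\ forall j, (j.+1 < J)%N -> x j.+1 - x j = J%:R^-1.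

Lemma mesh_weight_ge0 : 0 <= J%:R^-1 :> R.
Proof. by rewrite invr_ge0. Qed.

Definition nu : {measure set (measurableTypeR R) -> \bar R} :=
  mscale (NngNum mesh_weight_ge0)
    (msum (fun j => \d_(x j : measurableTypeR R)) J).

(* g k y s stands for g[u_k](y, s), and f k y for f_k(y). *)
Variables (g : 'I_n0 -> R -> R -> R) (f : 'I_n0 -> R -> R).

Definition data_in_L2 : Prop := forall k,
  measurable_fun (mesh `*` S01 : set (measurableTypeR R * measurableTypeR R))
    (fun p => g k p.1 p.2) /\
  (nu \x leb)%E.-integrable (mesh `*` S01) (fun p => (g k p.1 p.2 ^+ 2)%:E).

Definition data_bounded : Prop :=
  exists M : R, forall k y s, mesh y -> S01 s -> `|g k y s| <= M.

Definition Zconst : R := n0%:R^-1 *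
  \sum_(k < n0) \int[leb]_(s in S01) \int[nu]_(y in mesh) `|g k y s|.

Definition rhodot (s : R) : R :=
  (n0%:R * Zconst)^-1 * \sum_(k < n0) \int[nu]_(y in mesh) `|g k y s|.

Definition is_exploration_measure
    (rho : {measure set (measurableTypeR R) -> \bar R}) : Prop :=
  forall A : set (measurableTypeR R), measurable A ->
    rho A = (\int[leb]_(s in A `&` S01) (rhodot s)%:E)%E.

Definition Gker (s s' : R) : R :=
  n0%:R^-1 * \sum_(k < n0) \int[nu]_(y in mesh) (g k y s * g k y s').

Definition Gbar (s s' : R) : R :=
  if 0 < rhodot s * rhodot s' then Gker s s' / (rhodot s * rhodot s') else 0.

Definition Rphi (phi : R -> R) (k : 'I_n0) (y : R) : R :=
  \int[leb]_(s in S01) (phi s * g k y s).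

Definition loss (phi : R -> R) : R :=
  n0%:R^-1 * \sum_(k < n0) \sum_(j < J)
    `|Rphi phi k (x j) - f k (x j)| ^+ 2 * J%:R^-1.

Variable rho : {measure set (measurableTypeR R) -> \bar R}.

Definition LGbar (phi : R -> R) : R -> R :=
  fun s => \int[rho]_(s' in S01) (phi s' * Gbar s s').

Definition HG : set (R -> R) := in_range_sqrt rho S01 LGbar.

Definition HG_dot : (R -> R) -> (R -> R) -> R := range_sqrt_dot rho S01 LGbar.

Definition HG_normsq (phi : R -> R) : R := HG_dot phi phi.

Definition regularized_loss (lambda : R) (phi : R -> R) : R :=
  loss phi + lambda * HG_normsq phi.

(* The quotient is 0 where rhodot vanishes, since 0^-1 = 0. *)
Definition xi (k : 'I_n0) (j : 'I_J) : R -> R :=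
  LGbar (fun s => g k (x j) s / rhodot s).

Definition Sigma : 'M[R]_(n0 * J) :=
  \matrix_(p, q) HG_dot (xi (pair_of_index p).1 (pair_of_index p).2)
                        (xi (pair_of_index q).1 (pair_of_index q).2).

Definition fvec : 'cV[R]_(n0 * J) :=
  \col_p f (pair_of_index p).1 (x (pair_of_index p).2).

Definition xi_comb (c : 'cV[R]_(n0 * J)) : R -> R :=
  fun s => \sum_(k < n0) \sum_(j < J) c (mxvec_index k j) 0 * xi k j s.

Definition vec_loss (c : 'cV[R]_(n0 * J)) : R :=
  (n0 * J)%:R^-1 * norm2sq (Sigma *m c - fvec).

Definition regularized_vec_loss (lambda : R) (c : 'cV[R]_(n0 * J)) : R :=
  vec_loss c + lambda * (c^T *m Sigma *m c) 0 0.

End Setting.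

(* Main.v *)
Require Import Defs.
From mathcomp Require Import all_boot all_order all_algebra.
From mathcomp Require Import all_classical all_reals all_analysis.
From mathcomp Require Import measurable_realfun.
From mathcomp Require complex.
From mathcomp Require Import ring lra.
Set Implicit Arguments.
Unset Strict Implicit.
Unset Printing Implicit Defensive.
Import Order.TTheory GRing.Theory Num.Theory.
Import numFieldNormedType.Exports.
Local Open Scope classical_set_scope.
Local Open Scope ring_scope.

(** Because nu is a sum of J point masses, the kernel is a finite sum,
    Gbar(s, s') = (n0 J)^-1 sum_q e_q(s) e_q(s') with e_q = g[u_k](x_j, .) /
    rhodot for q = (k, j), and the operator L of kernel Gbar has finite rank:
    L phi = (n0 J)^-1 sum_q <phi, e_q> e_q ([LGbarE]).  The e_q are bounded,
    since rhodot is a positive multiple of the sum of all |g[u_k](x_j, .)|.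

    Everything about H_Gbar follows from three facts about L^{1/2}.  It exists:
    on the span of the e_q, it is given by a power of their Gram matrix K,
    proportional to K^{-1/2} on the range of K, which is a polynomial in K
    ([psd_fourth_root], [finite_rank_sqrt]).  It has the same null space as L,
    because <L f, f> = |L^{1/2} f|^2 for any positive square root.  And every
    square integrable function is the sum of an element of N(L) and one of its
    orthogonal complement, here the span of the e_q ([finite_rank_split]).
    Hence L^{-1/2} is well defined and linear up to null sets, the form on
    H_Gbar is an inner product up to null sets, and
    L^{-1/2} (L e) = L^{1/2} e yields <L e, phi>_H = <e, phi>
    ([range_dot_image]).  For e = e_q the right-hand side is R_phi[u_k](x_j):
    the density rhodot cancels the denominator of e_q ([RphiE]).

    With this reproducing property, R_phi is the vector of the inner products
    of phi with the xi_q, and the loss is a quadratic function of that vector.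
    Let phi_c be the combination of the xi_q with coefficients c.  The
    residual r of the optimality condition of (a) or (b) satisfies
    Sigma r = 0.  Then sum_q r_q xi_q has norm zero, so r is orthogonal to
    R_phi for every phi in H, and completing the square gives an exact
    formula for the excess of the loss over its value at phi_c
    ([min_norm_least_squares], [tikhonov_minimizer]).  The excess is a positive
    definite expression in phi - phi_c, for (a) after the minimal norm is
    taken into account, whence uniqueness up to null sets.  The Penrose
    equations show that the coefficients of the theorem satisfy these
    optimality conditions. *)

(** * Euclidean geometry of real matrices *)

Section EuclideanNorm.
Context {R : realType}.

Lemma norm2sqE n (v : 'cV[R]_n) : norm2sq v = (v^T *m v) 0 0.
Proof. by rewrite mxE; apply: eq_bigr => i _; rewrite mxE expr2. Qed.

Lemma norm2sq_ge0 n (v : 'cV[R]_n) : 0 <= norm2sq v.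
Proof. by apply: sumr_ge0 => i _; exact: sqr_ge0. Qed.

Lemma norm2sq_eq0 n (v : 'cV[R]_n) : norm2sq v = 0 -> v = 0.
Proof.
move/psumr_eq0P => v0; apply/colP => i; rewrite mxE; apply/eqP.
by rewrite -sqrf_eq0 v0 // => j _; exact: sqr_ge0.
Qed.

Lemma norm2sqD n (u v : 'cV[R]_n) :
  norm2sq (u + v) = norm2sq u + 2 * (u^T *m v) 0 0 + norm2sq v.
Proof.
rewrite [X in _ = _ + _ * X + _]mxE mulr_sumr /norm2sq -!big_split /=.
by apply: eq_bigr => i _; rewrite !mxE; ring.
Qed.

Lemma mulmx_trr_eq0 m n (A : 'M[R]_(m, n)) : A *m A^T = 0 -> A = 0.
Proof.
move=> A0; apply/row_matrixP => i; rewrite row0 -[LHS]trmxK.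
rewrite [X in X^T](_ : _ = 0) ?trmx0 //; apply: norm2sq_eq0.
rewrite norm2sqE trmxK tr_row.
have /matrixP/(_ i i) := A0; rewrite !mxE; apply: etrans.
by apply: eq_bigr => j _; rewrite !mxE.
Qed.

Lemma gram_unitmx m n (A : 'M[R]_(m, n)) : row_free A -> A *m A^T \in unitmx.
Proof.
move=> Afree; rewrite -row_free_unit; apply/inj_row_free => v vAA.
apply/eqP; rewrite -(mulmx_free_eq0 _ Afree); apply/eqP/mulmx_trr_eq0.
by rewrite trmx_mul mulmxA -(mulmxA v) vAA mul0mx.
Qed.

End EuclideanNorm.

Section Pseudoinverse.
Context {R : realType}.

Lemma gram_projection_sym m n (A : 'M[R]_(m, n)) :
  let P := A^T *m invmx (A *m A^T) *m A in P^T = P.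
Proof. by rewrite /= !trmx_mul trmx_inv trmx_mul trmxK mulmxA. Qed.

(** With a full rank factorization A = C F, the pseudoinverse is
    F^T (F F^T)^-1 (C^T C)^-1 C^T; then A P and P A are the orthogonal
    projections attached to C and F. *)
Lemma exists_pseudoinverse m n (A : 'M[R]_(m, n)) :
  exists P, is_pseudoinverse A P.
Proof.
have [r [C [F [Cfull Ffree AE]]]] :
    exists r (C : 'M[R]_(m, r)) (F : 'M[R]_(r, n)),
    [/\ row_full C, row_free F & A = C *m F].
  exists (\rank A), (col_base A), (row_base A).
  by rewrite col_base_full row_base_free mulmx_base.
have uF : F *m F^T \in unitmx by exact: gram_unitmx.
have uC : C^T *m C \in unitmx.
  by rewrite -{2}(trmxK C); apply: gram_unitmx; rewrite /row_free mxrank_tr.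
pose P := F^T *m invmx (F *m F^T) *m (invmx (C^T *m C) *m C^T).
have AP : A *m P = C *m invmx (C^T *m C) *m C^T.
  by rewrite AE /P !mulmxA -(mulmxA C F) mulmxK.
have PA : P *m A = F^T *m invmx (F *m F^T) *m F.
  by rewrite AE /P !mulmxA -[_ *m C^T *m C]mulmxA mulmxKV.
exists P; split.
- by rewrite AP {1}AE !mulmxA -[_ *m C^T *m C]mulmxA mulmxKV.
- by rewrite PA /P !mulmxA -[_ *m F *m F^T]mulmxA mulmxKV.
- by rewrite AP; have := gram_projection_sym C^T; rewrite trmxK.
- by rewrite PA; exact: gram_projection_sym.
Qed.

Lemma pseudoinverseP m n (A : 'M[R]_(m, n)) :
  is_pseudoinverse A (pseudoinverse A).
Proof. exact: xgetPex (exists_pseudoinverse A). Qed.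

End Pseudoinverse.

Section Roots.
Context {R : realType}.

Lemma exists_interpolation (s : seq R) (h : R -> R) :
  exists p : {poly R}, {in s, forall t, p.[t] = h t}.
Proof.
elim: s => [|a s [p ps]]; first by exists 0.
have [as_|as_] := boolP (a \in s).
  by exists p => t; rewrite inE => /predU1P[->|]; exact: ps.
pose w := \prod_(b <- s) ('X - b%:P).
have wa : w.[a] != 0 by rewrite -/(root w a) root_prod_XsubC.
exists (p + ((h a - p.[a]) / w.[a])%:P * w) => t.
rewrite inE hornerD hornerM hornerC => /predU1P[->|ts].
  by rewrite divfK // addrC subrK.
have /rootP -> : root w t by rewrite root_prod_XsubC.
by rewrite mulr0 addr0 ps.
Qed.

Lemma trmx_horner_mx n (A : 'M[R]_n.+1) p :
  (horner_mx A p)^T = horner_mx A^T p.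
Proof.
elim/poly_ind: p => [|p c IHp]; first by rewrite !rmorph0 trmx0.
rewrite !rmorphD !rmorphM /= !horner_mx_X !horner_mx_C linearD /=.
rewrite trmx_mul IHp tr_scalar_mx; congr (_ + _).
exact/comm_mx_horner/comm_mx_refl.
Qed.

Section Spectral.
Import complex.

(** Real symmetric matrices are diagonalizable: over the complex numbers the
    matrix is Hermitian, so it is unitarily similar to a diagonal matrix with
    real entries, and these are eigenvalues of the real matrix.  A polynomial
    that vanishes on them therefore annihilates the matrix. *)
Lemma symmetric_mx_eigenvalues n (A : 'M[R]_n.+1) : A^T = A ->
  exists2 s : seq R, {in s, forall t, eigenvalue A t} &
    forall p, {in s, forall t, p.[t] = 0} -> horner_mx A p = 0.
Proof.
move=> Asym; pose AC := map_mx (real_complex R) A.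
have hAC : AC \is hermsymmx.
  apply: realsym_hermsym.
    apply/is_hermitianmxP; rewrite expr0 scale1r map_mx_id //.
    by rewrite /AC map_trmx Asym.
  by apply/mxOverP => i j; rewrite mxE complex_real.
have /orthomx_spectralP ACE := hermitian_normalmx hAC.
have /mxOverP Dreal := hermitian_spectral_diag_real hAC.
set P := spectralmx AC in ACE; set D := spectral_diag AC in ACE Dreal.
have uP : P \in unitmx by exact: spectral_unit.
have DE i : D 0 i = real_complex R (complex.Re (D 0 i)).
  by rewrite RRe_real.
exists [seq complex.Re (D 0 i) | i <- enum 'I_n.+1].
  move=> _ /mapP[i _ ->].
  rewrite -(eigenvalue_map (real_complex R)) -[X in eigenvalue _ X]DE -/AC.
  apply/eigenvalueP; exists (row i P).
    rewrite -row_mul ACE !mulmxA mulmxV // mul1mx row_mul row_diag_mx.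
    by rewrite -scalemxAl -rowE.
  apply/eqP => rP0; have := mulmxV uP; move/(congr1 (row i)).
  rewrite row_mul rP0 mul0mx => /rowP/(_ i); rewrite !mxE eqxx => /eqP.
  by rewrite eq_sym oner_eq0.
move=> p pD; apply/eqP; rewrite -(map_mx_eq0 (real_complex R)).
rewrite map_horner_mx -/AC ACE.
rewrite horner_mx_uconjC // horner_mx_diag (_ : map_mx _ _ = 0).
  by rewrite linear0 mulmx0 mul0mx.
apply/rowP => i; rewrite !mxE DE horner_map pD ?rmorph0 //.
by apply: map_f; rewrite mem_enum.
Qed.

End Spectral.

(** On the positive eigenvalues, Q^4 is a K^-1: this is the form in which
    K^{-1/2} will define the square root of a finite rank operator.  Taking a
    fourth root makes Q^2 positive semidefinite for free, and obtaining Q as a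
    polynomial in K makes it symmetric and real. *)
Lemma psd_fourth_root n (K : 'M[R]_n) (a : R) : K^T = K ->
  (forall v : 'rV[R]_n, 0 <= (v *m K *m v^T) 0 0) -> 0 <= a ->
  exists Q : 'M[R]_n,
    Q^T = Q /\ Q *m Q *m K *m (Q *m Q) *m K = a *: K.
Proof.
case: n K => [|n] K Ksym Kpsd a_ge0.
  by exists 0; split; apply/matrixP => -[].
have [s sK pK] := symmetric_mx_eigenvalues Ksym.
have s_ge0 : {in s, forall t, 0 <= t}.
  move=> t /sK/eigenvalueP[v vK v0]; have := Kpsd v.
  rewrite vK -scalemxAl mxE -[v in v *m _]trmxK -norm2sqE.
  rewrite pmulr_lge0 // lt_neqAle norm2sq_ge0 andbT eq_sym.
  apply: contra v0 => /eqP/norm2sq_eq0 /(congr1 trmx).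
  by rewrite trmxK trmx0 => ->.
(* for t > 0, the fourth root of a / t *)
have [r rs] := exists_interpolation s (fun t => Num.sqrt (Num.sqrt (a / t))).
exists (horner_mx K r); split.
  by rewrite trmx_horner_mx Ksym.
have : horner_mx K (r * r * 'X * (r * r) * 'X - a%:P * 'X) = 0; last first.
  rewrite rmorphB !rmorphM /= horner_mx_X horner_mx_C => /eqP.
  by rewrite subr_eq0 => /eqP; rewrite -mul_scalar_mx.
apply: pK => t ts.
rewrite hornerD hornerN !hornerM hornerC hornerX rs //.
have [->|t0] := eqVneq t 0; first by rewrite !mulr0 subrr.
set q := Num.sqrt (Num.sqrt _).
have qE : q * q * (q * q) = a / t.
  rewrite -!expr2 !sqr_sqrtr ?sqrtr_ge0 //.
  by rewrite divr_ge0 // s_ge0.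
by transitivity (q * q * (q * q) * t * t - a * t);
  [ring | rewrite qE divfK // subrr].
Qed.

End Roots.

(** * Least squares in coordinates and in a semi-inner product space *)

Section MatrixLeastSquares.
Context {R : realType}.

Lemma normal_equation_pythagoras m n (A : 'M[R]_(m, n)) (f : 'cV[R]_m)
    (c d : 'cV[R]_n) :
  A^T *m (A *m c - f) = 0 ->
  norm2sq (A *m d - f) = norm2sq (A *m (d - c)) + norm2sq (A *m c - f).
Proof.
move=> Ac; rewrite (_ : A *m d - f = A *m (d - c) + (A *m c - f)); last first.
  by rewrite mulmxBr addrA subrK.
by rewrite norm2sqD trmx_mul -mulmxA Ac mulmx0 mxE mulr0 addr0.
Qed.

Lemma pseudoinverse_normal_equation m n (A : 'M[R]_(m, n)) (f : 'cV[R]_m) :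
  A^T *m (A *m (pseudoinverse A *m f) - f) = 0.
Proof.
have [APA _ APsym _] := pseudoinverseP A.
rewrite mulmxBr !mulmxA -(mulmxA A^T) -[A *m _]APsym -trmx_mul APA.
by rewrite subrr.
Qed.

(** The minimizers are the solutions d of A d = A c, for c = P f with P the
    pseudoinverse.  Since c = P A c and P A is symmetric, c is orthogonal to
    the null space of A, hence is the shortest of them. *)
Lemma pseudoinverse_least_squares m n (A : 'M[R]_(m, n)) (f : 'cV[R]_m)
    (a : R) : 0 < a ->
  argmin (argmin setT (fun d => a * norm2sq (A *m d - f))) (@norm2sq R n)
  = [set pseudoinverse A *m f].
Proof.
move=> a_gt0; set c := _ *m f.
have pyth d := normal_equation_pythagoras d (pseudoinverse_normal_equation A f).
have minE d : argmin setT (fun d => a * norm2sq (A *m d - f)) d <->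
    A *m (d - c) = 0.
  split=> [[_ /(_ c I)]|Adc].
    rewrite ler_pM2l // (pyth d) gerDr => A_le0; apply: norm2sq_eq0.
    by apply/eqP; rewrite eq_le A_le0 norm2sq_ge0.
  split=> // e _; rewrite ler_pM2l // (pyth d) (pyth e) Adc.
  rewrite (_ : norm2sq 0 = 0) ?add0r ?lerDr ?norm2sq_ge0 //.
  by rewrite norm2sqE mulmx0 mxE.
have cE : c = pseudoinverse A *m A *m c.
  by have [_ PAP _ _] := pseudoinverseP A; rewrite /c mulmxA PAP.
have normE d : A *m (d - c) = 0 -> norm2sq d = norm2sq c + norm2sq (d - c).
  move=> Adc; rewrite -[in LHS](subrKC c d) norm2sqD {2}cE trmx_mul.
  have [_ _ _ ->] := pseudoinverseP A.
  by rewrite -!mulmxA Adc !mulmx0 mxE mulr0 addr0.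
have Acc : A *m (c - c) = 0 by rewrite subrr mulmx0.
apply/seteqP; split=> [d [/minE Adc /(_ c)]|_ ->].
  move=> /(_ (iffRL (minE c) Acc)); rewrite normE // gerDl => dc_le0.
  apply/eqP; rewrite -subr_eq0; apply/eqP/norm2sq_eq0/eqP.
  by rewrite eq_le dc_le0 norm2sq_ge0.
split=> [|d /minE /normE ->]; first exact/minE.
by rewrite lerDl norm2sq_ge0.
Qed.

(** T = S^2 + b S factors as S W with W = S + b invertible, so S = T W^-1 has
    its range in that of T, and T c = S f. *)
Lemma tikhonov_normal_equation n (S : 'M[R]_n) (f : 'cV[R]_n) (b : R) :
    S^T = S -> (forall v : 'cV[R]_n, 0 <= (v^T *m S *m v) 0 0) -> 0 < b ->
  let c := pseudoinverse (S *m S + b *: S) *m (S *m f) in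
  S *m (S *m c - f + b *: c) = 0.
Proof.
move=> Ssym Spsd b_gt0; set T := _ + _ => c.
pose W := S + b%:M.
have uW : W \in unitmx.
  rewrite -row_free_unit; apply/inj_row_free => v vW.
  have := Spsd v^T; rewrite trmxK => vSv.
  have : (v *m W *m v^T) 0 0 = 0 by rewrite vW mul0mx mxE.
  rewrite mulmxDr mulmxDl mul_mx_scalar -scalemxAl mxE [X in _ + X]mxE.
  rewrite -{3}[v]trmxK -norm2sqE => /eqP.
  rewrite paddr_eq0 ?mulr_ge0 ?norm2sq_ge0 ?(ltW b_gt0) // mulf_eq0.
  rewrite (gt_eqF b_gt0) /= => /andP[_ /eqP/norm2sq_eq0/(congr1 trmx)].
  by rewrite trmxK trmx0.
have TE : T = S *m W by rewrite mulmxDr mul_mx_scalar.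
have SE : S = T *m invmx W by rewrite TE mulmxK.
have Tc : T *m c = S *m f.
  have [TPT _ _ _] := pseudoinverseP T.
  by rewrite /c mulmxA [in LHS]SE !mulmxA TPT -SE.
by rewrite !mulmxDr -scalemxAr mulmxN mulmxA addrAC scalemxAl -mulmxDl Tc subrr.
Qed.

End MatrixLeastSquares.

Section SemiInnerProduct.
Context {R : realType} {V : lmodType R}.

(** The form is a function on the whole ambient space V, linear on the subspace
    H: the form of H_Gbar is built from A^{-1/2}, which takes a junk value
    outside the range of A^{1/2}. *)
Record semi_inner_product (H : set V) (dot : V -> V -> R) : Prop := {
  sip_domain0 : H 0;
  sip_domainZD : forall a u v, H u -> H v -> H (a *: u + v);
  sip_dotC : forall u v, dot u v = dot v u;
  sip_dotZDl : forall a u v w, H u -> H v -> H w ->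
    dot (a *: u + v) w = a * dot u w + dot v w;
  sip_dot_ge0 : forall u, H u -> 0 <= dot u u
}.

Variables (H : set V) (dot : V -> V -> R).
Hypothesis HP : semi_inner_product H dot.

Lemma sip_domainB u v : H u -> H v -> H (u - v).
Proof. by move=> Hu Hv; rewrite addrC -scaleN1r; apply: (sip_domainZD HP). Qed.

Lemma sip_dotBl u v w : H u -> H v -> H w -> dot (u - v) w = dot u w - dot v w.
Proof.
move=> Hu Hv Hw; rewrite addrC -scaleN1r (sip_dotZDl HP) //; ring.
Qed.

Lemma sip_dotDD u v : H u -> H v ->
  dot (u + v) (u + v) = dot u u + 2 * dot u v + dot v v.
Proof.
move=> Hu Hv; have Huv : H (u + v).
  by rewrite -[u]scale1r; apply: (sip_domainZD HP).
rewrite -{1}[u]scale1r (sip_dotZDl HP) // !(sip_dotC HP _ (u + v)).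
rewrite -[u in dot (u + v)]scale1r !(sip_dotZDl HP) // (sip_dotC HP v u).
ring.
Qed.

(** Otherwise <t u + v, t u + v> is an affine function of t that takes negative
    values; t is chosen so that it equals -1. *)
Lemma sip_dot_null u v : H u -> H v -> dot u u = 0 -> dot u v = 0.
Proof.
move=> Hu Hv uu; apply/eqP; apply: contraT => uv.
pose t := - (dot v v + 1) / (2 * dot u v).
have Hw := sip_domainZD HP t Hu Hv; have := sip_dot_ge0 HP Hw.
rewrite (sip_dotZDl HP) //.
rewrite (sip_dotC HP u) (sip_dotC HP v) !(sip_dotZDl HP) // uu (sip_dotC HP v u).
have -> : t * (t * 0 + dot u v) + (t * dot u v + dot v v) = -1.
  by rewrite /t; field.
by rewrite oppr_ge0 ler10.
Qed.

Section Representers.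
Variables (m : nat) (xi : 'I_m -> V).
Hypothesis Hxi : forall p, H (xi p).

Definition gram : 'M[R]_m := \matrix_(p, q) dot (xi p) (xi q).
Definition samples (phi : V) : 'cV[R]_m := \col_p dot (xi p) phi.
Definition combination (c : 'cV[R]_m) : V := \sum_p c p 0 *: xi p.

Lemma combination_domain c : H (combination c).
Proof.
rewrite /combination; elim/big_ind: _ => [|u v Hu Hv|p _].
- exact: (sip_domain0 HP).
- by rewrite -[u]scale1r; apply: (sip_domainZD HP).
- rewrite -[_ *: _]addr0; apply: (sip_domainZD HP) => //.
  exact: (sip_domain0 HP).
Qed.

Lemma dot_combination c phi : H phi ->
  dot (combination c) phi = (c^T *m samples phi) 0 0.
Proof.
move=> Hphi.
have dot0 : dot 0 phi = 0.
  by rewrite -[X in dot X](subrr phi) sip_dotBl // subrr.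
suff [] : H (combination c) /\
  dot (combination c) phi = \sum_p c p 0 * dot (xi p) phi.
  by move=> _ ->; rewrite mxE; apply: eq_bigr => p _; rewrite !mxE.
rewrite /combination; elim/big_rec2: _ => [|p y u _ [Hu uE]].
  by split=> //; exact: (sip_domain0 HP).
by rewrite (sip_dotZDl HP) // uE; split=> //; exact: (sip_domainZD HP).
Qed.

Lemma samples_combination c : samples (combination c) = gram *m c.
Proof.
apply/colP => p; rewrite mxE (sip_dotC HP) dot_combination // !mxE.
by apply: eq_bigr => q _; rewrite !mxE mulrC (sip_dotC HP).
Qed.

Lemma samplesB phi psi : H phi -> H psi ->
  samples (phi - psi) = samples phi - samples psi.
Proof.
move=> Hphi Hpsi; apply/colP => p; rewrite !mxE.
by rewrite !(sip_dotC HP (xi p)) sip_dotBl.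
Qed.

Lemma gram_sym : gram^T = gram.
Proof. by apply/matrixP => p q; rewrite !mxE (sip_dotC HP). Qed.

Lemma gram_quadratic (c : 'cV[R]_m) :
  (c^T *m gram *m c) 0 0 = dot (combination c) (combination c).
Proof.
rewrite dot_combination; last exact: combination_domain.
by rewrite samples_combination mulmxA.
Qed.

Lemma gram_psd (c : 'cV[R]_m) : 0 <= (c^T *m gram *m c) 0 0.
Proof.
by rewrite gram_quadratic (sip_dot_ge0 HP) //; exact: combination_domain.
Qed.

(** The combination with coefficients v has norm v^T S v = 0. *)
Lemma gram_kernel_orthogonal (v : 'cV[R]_m) (phi : V) : gram *m v = 0 -> H phi ->
  ((samples phi)^T *m v) 0 0 = 0.
Proof.
move=> Sv Hphi; rewrite -[RHS](_ : dot (combination v) phi = 0).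
  by rewrite dot_combination // !mxE; apply: eq_bigr => p _; rewrite !mxE mulrC.
apply: sip_dot_null => //; first exact: combination_domain.
by rewrite -gram_quadratic -mulmxA Sv mulmx0 mxE.
Qed.

Section Minimizers.
Variables (a : R) (f : 'cV[R]_m).
Hypothesis a_gt0 : 0 < a.

(** The residual S c - f is orthogonal to all sample vectors, so minimizing F
    means having the same samples as the combination w with coefficients c.
    Such a phi differs from w by an element orthogonal to w, and Pythagoras
    gives N phi = N w + |phi - w|^2. *)
Lemma min_norm_least_squares (c : 'cV[R]_m) (F N : V -> R) :
    (forall phi, H phi -> F phi = a * norm2sq (samples phi - f)) ->
    (forall phi, N phi = dot phi phi) ->
    gram *m (gram *m c - f) = 0 ->
  argmin (argmin H F) N (combination c) /\
  forall phi, argmin (argmin H F) N phi ->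
    H phi /\ dot (phi - combination c) (phi - combination c) = 0.
Proof.
move=> FE NE Sc; set w := combination c.
have Hw : H w by exact: combination_domain.
have pyth phi : H phi -> F phi = a * norm2sq (samples (phi - w)) + F w.
  move=> Hphi; rewrite !FE // -mulrDr; congr (_ * _).
  rewrite -{1}(subrK w phi) (_ : samples (phi - w + w) - f =
    samples (phi - w) + (samples w - f)); last first.
    by rewrite subrK samplesB // addrA subrK.
  rewrite norm2sqD samples_combination gram_kernel_orthogonal //.
    by rewrite mulr0 addr0.
  exact: sip_domainB.
have minE phi : argmin H F phi <-> H phi /\ samples (phi - w) = 0.
  split=> [[Hphi /(_ w Hw)]|[Hphi s0]].
    rewrite pyth // gerDr pmulr_rle0 // => s_le0; split=> //.
    by apply/norm2sq_eq0/eqP; rewrite eq_le s_le0 norm2sq_ge0.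
  split=> // psi Hpsi; rewrite (pyth _ Hphi) (pyth _ Hpsi) s0 norm2sqE mulmx0.
  by rewrite mxE mulr0 add0r lerDr mulr_ge0 ?norm2sq_ge0 ?(ltW a_gt0).
have normE phi : H phi -> samples (phi - w) = 0 ->
    N phi = N w + dot (phi - w) (phi - w).
  move=> Hphi s0; have Hd : H (phi - w) by exact: sip_domainB.
  have := sip_dotDD Hw Hd; rewrite subrKC (dot_combination c Hd) s0 mulmx0.
  by rewrite !NE mxE mulr0 addr0.
have minw : argmin H F w.
  apply/minE; split=> //; rewrite samplesB // subrr //.
split=> [|phi [/minE[Hphi s0] /(_ w minw)]].
  split=> // phi /minE[Hphi s0]; rewrite (normE phi) // lerDl.
  by rewrite (sip_dot_ge0 HP) //; exact: sip_domainB.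
rewrite (normE phi) // gerDl => d_le0; split=> //; apply/eqP.
by rewrite eq_le d_le0 (sip_dot_ge0 HP) //; exact: sip_domainB.
Qed.

(** The first order terms at w in F cancel, since S c - f + b c is orthogonal to
    all sample vectors and <w, phi - w> is c paired with the samples of
    phi - w.  What remains of F phi - F w is a nonnegative quadratic form in
    phi - w that dominates a b |phi - w|^2. *)
Lemma tikhonov_minimizer (b : R) (c : 'cV[R]_m) (F : V -> R) : 0 < b ->
    (forall phi, H phi ->
      F phi = a * norm2sq (samples phi - f) + (a * b) * dot phi phi) ->
    gram *m (gram *m c - f + b *: c) = 0 ->
  argmin H F (combination c) /\
  forall phi, argmin H F phi ->
    H phi /\ dot (phi - combination c) (phi - combination c) = 0.
Proof.
move=> b_gt0 FE Sc; set w := combination c.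
have Hw : H w by exact: combination_domain.
have ab_gt0 : 0 < a * b by exact: mulr_gt0.
have excess phi : H phi -> F phi =
    F w + (a * norm2sq (samples (phi - w)) + (a * b) * dot (phi - w) (phi - w)).
  move=> Hphi; have Hd : H (phi - w) by exact: sip_domainB.
  have -> : F phi = a * norm2sq (samples (phi - w) + (samples w - f))
                    + (a * b) * dot (w + (phi - w)) (w + (phi - w)).
    rewrite FE // samplesB // subrKC; congr (_ * norm2sq _ + _).
    by rewrite addrA subrK.
  rewrite norm2sqD (sip_dotDD Hw Hd) (dot_combination c Hd) FE //.
  have := gram_kernel_orthogonal Sc Hd.
  rewrite -samples_combination -/w mulmxDr -scalemxAr mxE [X in _ + X]mxE.
  have -> : ((samples (phi - w))^T *m c) 0 0 = (c^T *m samples (phi - w)) 0 0.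
    by rewrite !mxE; apply: eq_bigr => p _; rewrite !mxE mulrC.
  set X := (_ *m (samples w - f)) 0 0; set Y := (c^T *m _) 0 0 => XY.
  have -> : X = - (b * Y) by apply/eqP; rewrite -addr_eq0 XY.
  ring.
split=> [|phi [Hphi /(_ w Hw)]].
  split=> // phi Hphi; rewrite (excess phi) // lerDl.
  rewrite addr_ge0 // mulr_ge0 ?norm2sq_ge0 ?(ltW a_gt0) ?(ltW ab_gt0) //.
  by rewrite (sip_dot_ge0 HP) //; exact: sip_domainB.
have d_ge0 : 0 <= dot (phi - w) (phi - w).
  by rewrite (sip_dot_ge0 HP) //; exact: sip_domainB.
rewrite (excess phi) // gerDl => E_le0; split=> //; apply/eqP.
rewrite eq_le d_ge0 andbT -(pmulr_rle0 _ ab_gt0); apply: le_trans E_le0.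
by rewrite lerDr mulr_ge0 ?norm2sq_ge0 ?(ltW a_gt0).
Qed.

End Minimizers.
End Representers.
End SemiInnerProduct.

(** * Square integrable functions *)

Section L2Theory.
Context {R : realType}.
Variables (mu : {measure set (measurableTypeR R) -> \bar R}) (S : set R).
Hypothesis mS : measurable (S : set (measurableTypeR R)).
Local Notation L2 := (in_L2 mu S).
Local Notation dot := (L2_dot mu S).
Local Notation "f =ae g" := (ae_eq mu S f g) (at level 70).
Implicit Types f g h : R -> R.

(** |f g| <= f^2 + g^2, which suffices for integrability. *)
Lemma L2_integrableM f g : L2 f -> L2 g ->
  mu.-integrable S (fun s => (f s * g s)%:E).
Proof.
move=> [mf f2] [mg g2].
have fg2 : mu.-integrable S (fun s => (f s ^+ 2)%:E + (g s ^+ 2)%:E)%E.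
  exact: integrableD.
apply: (le_integrable mS _ _ fg2) => [|s Ss].
  by apply/measurable_EFinP; exact: measurable_funM.
rewrite -EFinD !abse_EFin lee_fin [leRHS]ger0_norm ?addr_ge0 ?sqr_ge0 //.
have := sqr_ge0 (f s - g s); have := sqr_ge0 (f s + g s).
rewrite ler_norml => h1 h2; apply/andP; split; nra.
Qed.

Lemma in_L2_lin a f g : L2 f -> L2 g -> L2 (fun s => a * f s + g s).
Proof.
move=> fL gL; have [mf f2] := fL; have [mg g2] := gL; split.
  apply: measurable_funD => //; apply: measurable_funM => //.
rewrite (_ : (fun s => _) = (fun s => (a ^+ 2)%:E * (f s ^+ 2)%:E
    + ((2 * a)%:E * (f s * g s)%:E + (g s ^+ 2)%:E))%E); last first.
  by apply/funext => s; rewrite -!EFinM -!EFinD; congr EFin; ring.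
apply: integrableD => //; first exact: integrableZl.
by apply: integrableD => //; apply: integrableZl => //; exact: L2_integrableM.
Qed.

Lemma in_L2_0 : L2 (fun=> 0).
Proof.
by split=> //; under eq_fun do rewrite expr0n /=; exact: integrable0.
Qed.

Lemma in_L2B f g : L2 f -> L2 g -> L2 (fun s => f s - g s).
Proof.
move=> fL gL; rewrite (_ : (fun s => _) = (fun s => -1 * g s + f s)).
  exact: in_L2_lin.
by apply/funext => s; ring.
Qed.

Lemma L2_dotC f g : dot f g = dot g f.
Proof. by apply: eq_Rintegral => s _; rewrite mulrC. Qed.

Lemma L2_dot_linl a f g h : L2 f -> L2 g -> L2 h ->
  dot (fun s => a * f s + g s) h = a * dot f h + dot g h.
Proof.
move=> fL gL hL; rewrite /L2_dot.
transitivity (\int[mu]_(s in S) (a * (f s * h s) + g s * h s)).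
  by apply: eq_Rintegral => s _; ring.
have fh := L2_integrableM fL hL; have gh := L2_integrableM gL hL.
rewrite RintegralD ?RintegralZl //.
exact: (@integrableZl _ _ _ mu S mS a (fun s => (f s * h s)%:E)).
Qed.

Lemma L2_dotBl f g h : L2 f -> L2 g -> L2 h ->
  dot (fun s => f s - g s) h = dot f h - dot g h.
Proof.
move=> fL gL hL; rewrite (_ : (fun s => _) = (fun s => -1 * g s + f s)).
  by rewrite L2_dot_linl //; ring.
by apply/funext => s; ring.
Qed.

Lemma L2_dot_ge0 f : 0 <= dot f f.
Proof. by apply: Rintegral_ge0 => s _; rewrite -expr2 sqr_ge0. Qed.

Lemma L2_dot_ae f f' g g' : L2 f -> L2 f' -> L2 g -> L2 g' ->
  f =ae f' -> g =ae g' -> dot f g = dot f' g'.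
Proof.
move=> [mf _] [mf' _] [mg _] [mg' _] ff' gg'; congr fine.
apply: ae_eq_integral => //;
  try by apply/measurable_EFinP; exact: measurable_funM.
by move: ff' gg'; apply: filterS2 => s + + Ss => /(_ Ss) -> /(_ Ss) ->.
Qed.

Lemma L2_dot_eq0 f : L2 f -> dot f f = 0 -> f =ae (fun=> 0).
Proof.
move=> fL ff0; have [mf f2] := fL.
have ffL := L2_integrableM fL fL.
have : (\int[mu]_(s in S) `|(f s * f s)%:E| = 0)%E.
  transitivity (\int[mu]_(s in S) (f s * f s)%:E)%E.
    by apply: eq_integral => s _; rewrite gee0_abs // lee_fin -expr2 sqr_ge0.
  by rewrite -[LHS]fineK ?integrable_fin_num // -[fine _]/(dot f f) ff0.
have mff : measurable_fun S (fun s => (f s * f s)%:E).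
  by apply/measurable_EFinP; exact: measurable_funM.
move/(proj1 (ae_eq_integral_abs mu mS mff)).
apply: filterS => s + Ss => /(_ Ss) [] /eqP; rewrite mulf_eq0 orbb => /eqP.
done.
Qed.

Lemma L2_dot_null f g : L2 f -> L2 g -> f =ae (fun=> 0) -> dot f g = 0.
Proof.
move=> fL gL f0; rewrite (L2_dot_ae fL in_L2_0 gL gL) //.
  by rewrite /L2_dot; under eq_Rintegral do rewrite mul0r; rewrite /Rintegral integral0.
exact: ae_eq_refl.
Qed.

Lemma ae_eq_subr0 f g : (fun s => f s - g s) =ae (fun=> 0) -> f =ae g.
Proof. by apply: filterS => s + Ss => /(_ Ss)/eqP; rewrite subr_eq0 => /eqP. Qed.

Lemma in_L2_sum m (e : 'I_m -> R -> R) (c : 'I_m -> R) :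
  (forall q, L2 (e q)) -> L2 (fun s => \sum_q c q * e q s).
Proof.
move=> eL; elim: (index_enum 'I_m) => [|q r IHr].
  by under eq_fun do rewrite big_nil; exact: in_L2_0.
by under eq_fun do rewrite big_cons; exact: in_L2_lin.
Qed.

Lemma L2_dot_suml m (e : 'I_m -> R -> R) (c : 'I_m -> R) h :
    (forall q, L2 (e q)) -> L2 h ->
  dot (fun s => \sum_q c q * e q s) h = \sum_q c q * dot (e q) h.
Proof.
move=> eL hL.
suff: forall r, L2 (fun s => \sum_(q <- r) c q * e q s) /\
   dot (fun s => \sum_(q <- r) c q * e q s) h = \sum_(q <- r) c q * dot (e q) h.
  by move=> /(_ (index_enum 'I_m))[].
elim=> [|q r [IHL IHr]].
  under eq_fun do rewrite big_nil; split; first exact: in_L2_0.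
  by rewrite big_nil L2_dot_null //; [exact: in_L2_0|exact: ae_eq_refl].
under eq_fun do rewrite big_cons; split; first exact: in_L2_lin.
by rewrite big_cons L2_dot_linl // IHr.
Qed.

(** * The range of a positive square root *)

(** The theory of the range space rests on two properties of A: it has a
    positive square root, and its null space splits off L^2.  Both are
    established for finite rank operators further on. *)
Section RangeSqrt.
Variable A : (R -> R) -> (R -> R).
Hypothesis A_sqrt : exists B, is_sqrt_operator mu S A B.
Hypothesis A_split : forall psi, L2 psi -> exists eta,
  L2_null mu S A eta /\ L2_null_orth mu S A (fun s => psi s - eta s).
Local Notation B := (sqrt_operator mu S A).
Local Notation inv_sqrt := (inv_sqrt_operator mu S A).
Local Notation range := (in_range_sqrt mu S A).
Local Notation hdot := (range_sqrt_dot mu S A).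

Let BP : is_sqrt_operator mu S A B.
Proof. exact: (xgetPex (id : (R -> R) -> (R -> R)) A_sqrt). Qed.

Let B_L2 f : L2 f -> L2 (B f). Proof. by case: BP => -[+ _ _] _ _ _; exact. Qed.
Let B_ae f g : L2 f -> L2 g -> f =ae g -> B f =ae B g.
Proof. by case: BP => -[_ + _] _ _ _; exact. Qed.
Let B_lin a f g : L2 f -> L2 g ->
  B (fun s => a * f s + g s) =ae (fun s => a * B f s + B g s).
Proof. by case: BP => -[_ _ +] _ _ _; exact. Qed.
Let B_sym f g : L2 f -> L2 g -> dot (B f) g = dot f (B g).
Proof. by case: BP => _ + _ _; exact. Qed.
Let BB f : L2 f -> B (B f) =ae A f.
Proof. by case: BP => _ _ _; exact. Qed.

Let B_sub f g : L2 f -> L2 g -> B (fun s => f s - g s) =ae (fun s => B f s - B g s).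
Proof.
move=> fL gL; rewrite (_ : (fun s => f s - _) = (fun s => -1 * g s + f s)).
  apply: ae_eq_trans (B_lin _ gL fL) _.
  by apply/aeW => s _ /=; ring.
by apply/funext => s; ring.
Qed.

Let B_0 : B (fun=> 0) =ae (fun=> 0).
Proof.
have E : (fun s : R => (0 : R) - 0) = (fun=> 0) by apply/funext => s; rewrite subrr.
have B00 : B (fun s : R => (0 : R) - 0) =ae (fun s => B (fun=> 0) s - B (fun=> 0) s).
  exact: B_sub in_L2_0 in_L2_0.
rewrite E in B00; apply: ae_eq_trans B00 _.
by apply/aeW => s _ /=; rewrite subrr.
Qed.

(** |B f|^2 = <B B f, f> = <A f, f> for the square root B of A. *)
Lemma null_sqrt f : L2_null mu S A f -> B f =ae (fun=> 0).
Proof.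
move=> [fL Af]; apply: L2_dot_eq0; first exact: B_L2.
rewrite B_sym //; last exact: B_L2.
rewrite L2_dotC L2_dot_null //; first by do 2 apply: B_L2.
exact: ae_eq_trans (BB fL) Af.
Qed.

Lemma sqrt_null f : L2 f -> B f =ae (fun=> 0) -> L2_null mu S A f.
Proof.
move=> fL Bf; split=> //; apply: ae_eq_trans (ae_eq_sym (BB fL)) _.
exact: ae_eq_trans (B_ae (B_L2 fL) in_L2_0 Bf) B_0.
Qed.

(** The difference of f and g lies in N(A), as N(B) = N(A), and is orthogonal
    to it. *)
Lemma null_orth_sqrt_inj f g :
    L2_null_orth mu S A f -> L2_null_orth mu S A g ->
  B f =ae B g -> f =ae g.
Proof.
move=> [fL fN] [gL gN] Bfg; have dL := in_L2B fL gL.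
apply/ae_eq_subr0/L2_dot_eq0 => //.
have dN : L2_null mu S A (fun s => f s - g s).
  apply: sqrt_null => //; apply: ae_eq_trans (B_sub fL gL) _.
  by move: Bfg; apply: filterS => s + Ss => /(_ Ss) ->; rewrite subrr.
by rewrite L2_dotBl // fN // gN // subrr.
Qed.

Lemma null_orth_lin a f g :
    L2_null_orth mu S A f -> L2_null_orth mu S A g ->
  L2_null_orth mu S A (fun s => a * f s + g s).
Proof.
move=> [fL fN] [gL gN]; split=> [|h hN]; first exact: in_L2_lin.
by rewrite L2_dot_linl ?fN ?gN ?mulr0 ?addr0 //; case: hN.
Qed.

(** A preimage of f under the square root can be corrected by its component in
    the null space without changing its image. *)
Lemma inv_sqrtP f : range f ->
  L2_null_orth mu S A (inv_sqrt f) /\ B (inv_sqrt f) =ae f.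
Proof.
move=> [fL [psi psiL fpsi]].
apply: (@xgetPex _ (cst 0 : R -> R) [set psi | L2_null_orth mu S A psi /\ B psi =ae f]).
have [eta [etaN etaO]] := A_split psiL; exists (fun s => psi s - eta s).
split=> //; apply: ae_eq_trans (ae_eq_sym fpsi).
apply: ae_eq_trans (B_sub psiL (proj1 etaN)) _.
by move: (null_sqrt etaN); apply: filterS => s + Ss => /(_ Ss) ->; rewrite subr0.
Qed.

Lemma inv_sqrt_L2 f : range f -> L2 (inv_sqrt f).
Proof. by move=> /inv_sqrtP[[]]. Qed.

Lemma inv_sqrt_unique f g :
  range f -> L2_null_orth mu S A g -> B g =ae f -> inv_sqrt f =ae g.
Proof.
move=> /inv_sqrtP[fN Bf] gN Bg; apply: null_orth_sqrt_inj => //.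
exact: ae_eq_trans Bf (ae_eq_sym Bg).
Qed.

Lemma range_lin a f g : range f -> range g -> range (fun s => a * f s + g s).
Proof.
move=> [fL [f' fL' ff']] [gL [g' gL' gg']]; split; first exact: in_L2_lin.
exists (fun s => a * f' s + g' s); first exact: in_L2_lin.
apply: ae_eq_trans (ae_eq_sym (B_lin a fL' gL')).
by move: ff' gg'; apply: filterS2 => s + + Ss => /(_ Ss) -> /(_ Ss) ->.
Qed.

Lemma range_0 : range (fun=> 0).
Proof.
split; first exact: in_L2_0.
exists (fun=> 0); first exact: in_L2_0.
exact: ae_eq_sym B_0.
Qed.

Lemma inv_sqrt_lin a f g : range f -> range g ->
  inv_sqrt (fun s => a * f s + g s) =ae
  (fun s => a * inv_sqrt f s + inv_sqrt g s).
Proof.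
move=> rf rg; have [fN Bf] := inv_sqrtP rf; have [gN Bg] := inv_sqrtP rg.
apply: inv_sqrt_unique; [exact: range_lin|exact: null_orth_lin|].
apply: ae_eq_trans (B_lin a (proj1 fN) (proj1 gN)) _.
by move: Bf Bg; apply: filterS2 => s + + Ss => /(_ Ss) -> /(_ Ss) ->.
Qed.

Lemma range_dotC f g : hdot f g = hdot g f.
Proof. exact: L2_dotC. Qed.

Lemma range_dot_lin a f g h : range f -> range g -> range h ->
  hdot (fun s => a * f s + g s) h = a * hdot f h + hdot g h.
Proof.
move=> rf rg rh; rewrite -L2_dot_linl; try exact: inv_sqrt_L2.
apply: L2_dot_ae; rewrite -?[L2 (fun=> _)]/(L2 _);
  try by [exact: inv_sqrt_L2 | exact/inv_sqrt_L2/range_lin | exact: ae_eq_refl].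
  by apply: in_L2_lin; exact: inv_sqrt_L2.
exact: inv_sqrt_lin.
Qed.

Lemma range_dot_ge0 f : 0 <= hdot f f.
Proof. exact: L2_dot_ge0. Qed.

Lemma range_dot_eq0 f : range f -> hdot f f = 0 -> f =ae (fun=> 0).
Proof.
move=> rf ff0; have [fN Bf] := inv_sqrtP rf.
apply: ae_eq_trans (ae_eq_sym Bf) _.
have /(B_ae (inv_sqrt_L2 rf) in_L2_0) B0 := L2_dot_eq0 (inv_sqrt_L2 rf) ff0.
exact: ae_eq_trans B0 B_0.
Qed.

Lemma range_image e : L2 e -> L2 (A e) -> range (A e).
Proof.
move=> eL AeL; split=> //; exists (B e); first exact: B_L2.
exact/ae_eq_sym/BB.
Qed.

(** B e is orthogonal to N(A) and B (B e) = A e, so A^{-1/2} (A e) = B e and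
    <A e, f>_H = <B e, A^{-1/2} f> = <e, B (A^{-1/2} f)> = <e, f>. *)
Lemma range_dot_image e f : L2 e -> L2 (A e) -> range f ->
  hdot (A e) f = dot e f.
Proof.
move=> eL AeL rf; have [fN Bf] := inv_sqrtP rf.
have fL := inv_sqrt_L2 rf.
have BeN : L2_null_orth mu S A (B e).
  split=> [|h hN]; first exact: B_L2.
  have [hL _] := hN; rewrite B_sym // L2_dotC L2_dot_null //; first exact: B_L2.
  exact: null_sqrt.
have invAe : inv_sqrt (A e) =ae B e.
  by apply: inv_sqrt_unique => //; [exact: range_image|exact: BB].
have rAe := range_image eL AeL.
rewrite /range_sqrt_dot (L2_dot_ae (inv_sqrt_L2 rAe) (B_L2 eL) fL fL) //.
  rewrite B_sym //; apply: L2_dot_ae => //.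
  - exact: B_L2.
  - by case: rf.
  - exact: ae_eq_refl.
exact: ae_eq_refl.
Qed.

End RangeSqrt.
End L2Theory.

(** * Finite rank operators *)

Section FiniteRankOperator.
Context {R : realType}.
Variables (mu : {measure set (measurableTypeR R) -> \bar R}) (S : set R).
Hypothesis mS : measurable (S : set (measurableTypeR R)).
Local Notation L2 := (in_L2 mu S).
Local Notation dot := (L2_dot mu S).
Local Notation "f =ae g" := (ae_eq mu S f g) (at level 70).
Variables (m : nat) (e : 'I_m -> R -> R).
Hypothesis eL2 : forall q, L2 (e q).

Definition coefs (phi : R -> R) : 'rV[R]_m := \row_q dot phi (e q).
Definition lincomb (c : 'rV[R]_m) : R -> R := fun s => \sum_q c 0 q * e q s.
Definition L2_gram : 'M[R]_m := \matrix_(p, q) dot (e p) (e q).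

Lemma lincomb_L2 c : L2 (lincomb c).
Proof. exact: in_L2_sum. Qed.

Lemma lincombZD a c d : lincomb (a *: c + d) = fun s => a * lincomb c s + lincomb d s.
Proof.
apply/funext => s; rewrite /lincomb mulr_sumr -big_split /=.
by apply: eq_bigr => q _; rewrite !mxE; ring.
Qed.

Lemma coefsZD a f g : L2 f -> L2 g ->
  coefs (fun s => a * f s + g s) = a *: coefs f + coefs g.
Proof. by move=> fL gL; apply/rowP => q; rewrite !mxE L2_dot_linl. Qed.

Lemma coefs_ae f g : L2 f -> L2 g -> f =ae g -> coefs f = coefs g.
Proof.
move=> fL gL fg; apply/rowP => q; rewrite !mxE; apply: L2_dot_ae => //.
exact: ae_eq_refl.
Qed.

Lemma dot_lincomb c f : L2 f -> dot (lincomb c) f = (c *m (coefs f)^T) 0 0.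
Proof.
move=> fL; rewrite L2_dot_suml // mxE; apply: eq_bigr => q _.
by rewrite !mxE L2_dotC.
Qed.

Lemma coefs_lincomb c : coefs (lincomb c) = c *m L2_gram.
Proof.
apply/rowP => q; rewrite mxE L2_dot_suml // mxE.
by apply: eq_bigr => p _; rewrite mxE.
Qed.

Lemma L2_gram_sym : L2_gram^T = L2_gram.
Proof. by apply/matrixP => p q; rewrite !mxE L2_dotC. Qed.

Lemma dot_lincomb2 c d : dot (lincomb c) (lincomb d) = (c *m L2_gram *m d^T) 0 0.
Proof.
rewrite dot_lincomb; last exact: lincomb_L2.
by rewrite coefs_lincomb trmx_mul L2_gram_sym mulmxA.
Qed.

Lemma L2_gram_psd (v : 'rV[R]_m) : 0 <= (v *m L2_gram *m v^T) 0 0.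
Proof. by rewrite -dot_lincomb2 L2_dot_ge0. Qed.

Lemma lincomb_null c : c *m L2_gram = 0 -> lincomb c =ae (fun=> 0).
Proof.
move=> cK; apply: L2_dot_eq0 => //; first exact: lincomb_L2.
by rewrite dot_lincomb2 cK mul0mx mxE.
Qed.

Lemma lincomb_ae c d : c *m L2_gram = d *m L2_gram -> lincomb c =ae lincomb d.
Proof.
move=> cd; have : (-1 *: c + d) *m L2_gram = 0.
  by rewrite mulmxDl -scalemxAl cd scaleN1r addNr.
move/lincomb_null; rewrite lincombZD; apply: filterS => s + Ss => /(_ Ss).
lra.
Qed.

Variables (a : R) (A : (R -> R) -> (R -> R)).
Hypothesis a_gt0 : 0 < a.
Hypothesis AE : forall f, L2 f -> A f = lincomb (a *: coefs f).

(** With u the coefficients of f, the root maps f to the combination with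
    coefficients u Q^2.  Applying it twice gives u Q^2 K Q^2 in place of a u;
    the two agree after multiplication by the Gram matrix K, which is enough
    because coefficients killed by K give the zero element. *)
Lemma finite_rank_sqrt : exists B, is_sqrt_operator mu S A B.
Proof.
have [Q [Qsym QK]] := psd_fourth_root L2_gram_sym L2_gram_psd (ltW a_gt0).
pose B f := lincomb (coefs f *m (Q *m Q)).
have dotB f g : L2 g -> dot (B f) g = (coefs f *m (Q *m Q) *m (coefs g)^T) 0 0.
  by move=> gL; rewrite dot_lincomb.
exists B; split.
- split=> [f fL|f g fL gL fg|b f g fL gL]; first exact: lincomb_L2.
    by rewrite /B (coefs_ae fL gL fg); exact: ae_eq_refl.
  rewrite /B coefsZD // mulmxDl -scalemxAl lincombZD; exact: ae_eq_refl.
- move=> f g fL gL; rewrite dotB // L2_dotC dotB //.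
  have -> : coefs g *m (Q *m Q) *m (coefs f)^T =
            (coefs f *m (Q *m Q) *m (coefs g)^T)^T.
    by rewrite !trmx_mul trmxK Qsym !mulmxA.
  by rewrite [RHS]mxE.
- move=> f fL; rewrite dotB // mulmxA -mulmxA -{2}Qsym -trmx_mul.
  by rewrite -[X in X *m _]trmxK -norm2sqE norm2sq_ge0.
move=> f fL; rewrite AE // /B coefs_lincomb; apply: lincomb_ae.
set K := L2_gram.
transitivity (coefs f *m (Q *m Q *m K *m (Q *m Q) *m K)).
  by rewrite !mulmxA.
by rewrite QK -scalemxAr scalemxAl.
Qed.

Lemma finite_rank_null f : L2_null mu S A f <-> L2 f /\ coefs f = 0.
Proof.
split=> [[fL Af]|[fL f0]]; split=> //; last first.
  rewrite AE // f0 scaler0; apply/aeW => s _.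
  by rewrite /lincomb big1 // => q _; rewrite mxE mul0r.
have : dot (A f) f = 0.
  by apply: L2_dot_null => //; rewrite AE //; exact: lincomb_L2.
rewrite AE // dot_lincomb // -scalemxAl mxE -{1}[coefs f]trmxK -norm2sqE.
move/eqP; rewrite mulf_eq0 gt_eqF //= => /eqP/norm2sq_eq0/(congr1 trmx).
by rewrite trmxK trmx0.
Qed.

(** The projection of psi on the span of the e_q has coefficients u P^T, with u
    the coefficients of psi and P the pseudoinverse of the Gram matrix K.  For
    this one needs u P^T K = u: the rows of K P - 1 are killed by K, so they
    give null combinations, whose inner products with psi vanish. *)
Lemma finite_rank_split psi : L2 psi -> exists eta,
  L2_null mu S A eta /\ L2_null_orth mu S A (fun s => psi s - eta s).
Proof.
move=> psiL; set u := coefs psi; set K := L2_gram; set P := pseudoinverse K.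
have [KPK _ _ _] := pseudoinverseP K.
have uE : u *m P^T *m K = u.
  have KPu : (K *m P - 1%:M) *m u^T = 0.
    apply/row_matrixP => i; rewrite row_mul row0; set d := row i _.
    have dK : d *m K = 0 by rewrite -row_mul mulmxBl KPK mul1mx subrr row0.
    apply/matrixP => j k; rewrite !ord1 -dot_lincomb // mxE.
    by apply: L2_dot_null => //; [exact: lincomb_L2|exact: lincomb_null].
  rewrite -mulmxA -[X in _ *m X]trmxK trmx_mul trmxK L2_gram_sym.
  apply: trmx_inj; rewrite trmx_mul trmxK; apply/eqP.
  by rewrite -subr_eq0 -{2}[u^T]mul1mx -mulmxBl KPu.
pose w := lincomb (u *m P^T); have wL : L2 w by exact: lincomb_L2.
exists (fun s => -1 * w s + psi s); split.
  apply/finite_rank_null; split; first exact: in_L2_lin.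
  by rewrite coefsZD // coefs_lincomb uE scaleN1r addNr.
rewrite (_ : (fun s => _) = w); last by apply/funext => s; ring.
split=> // h /finite_rank_null[hL h0].
by rewrite dot_lincomb // h0 trmx0 mulmx0 mxE.
Qed.

Lemma finite_rank_L2 f : L2 f -> L2 (A f).
Proof. by move=> fL; rewrite AE //; exact: lincomb_L2. Qed.

End FiniteRankOperator.

(** * Integrals against a density and against the mesh measure *)

Section Density.
Context d (T : measurableType d) (R : realType).
Variables (mu : {sigma_finite_measure set T -> \bar R}).
Variables (rho : {measure set T -> \bar R}) (D : set T) (w : T -> R).
Hypothesis mD : measurable D.
Hypothesis w_int : mu.-integrable D (fun s => (w s)%:E).
Hypothesis rhoE : forall A, measurable A ->
  rho A = (\int[mu]_(s in A `&` D) (w s)%:E)%E.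

Lemma density_finite : (rho D < +oo)%E.
Proof. by rewrite rhoE // setIid integrable_lty. Qed.

(** By uniqueness of the Radon-Nikodym derivative, it is w almost everywhere
    on D.  The restriction of rho to D is a finite measure, to which the change
    of variables by the derivative applies. *)
Lemma Rintegral_density (h : T -> R) :
    rho.-integrable D (fun s => (h s)%:E) ->
  \int[rho]_(s in D) h s = \int[mu]_(s in D) (h s * w s).
Proof.
move=> h_int; pose rhoF : {finite_measure set T -> \bar R} :=
  mfrestr mD density_finite.
have rhoFE (f : T -> \bar R) :
    (\int[rho]_(s in D) f s = \int[rhoF]_(s in D) f s)%E.
  by apply: eq_measure_integral => A mA AD; rewrite /= /mfrestr /mrestr setIidl.
have dom : rhoF `<< mu.
  apply/null_content_dominatesP => A mA muA.
  have mAD : measurable (A `&` D) by exact: measurableI.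
  rewrite /= /mfrestr /mrestr rhoE // -setIA setIid.
  apply: null_set_integral => //.
    exact: measurable_funS (measurable_int _ w_int).
  exact: (@subset_measure0 _ _ _ _ _ A).
have h_int' : rhoF.-integrable D (fun s => (h s)%:E).
  move/integrableP: h_int => [mh hoo]; apply/integrableP; split=> //.
  by rewrite -rhoFE.
rewrite /Rintegral rhoFE.
rewrite -(Radon_Nikodym_change_of_variables dom mD h_int').
congr fine; apply: ae_eq_integral => //.
- apply: emeasurable_funM; first exact: measurable_int h_int.
  by apply: measurable_funTS.
- under eq_fun do rewrite EFinM.
  apply: emeasurable_funM; first exact: measurable_int h_int.
  exact: measurable_int w_int.
under [X in ae_eq _ _ _ X]eq_fun do rewrite EFinM.
apply: ae_eqe_mul2l; apply: integral_ae_eq => //.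
- apply: (integrableS measurableT _ (@subsetT _ _)) => //.
  exact: Radon_Nikodym_integrable.
- exact: measurable_int w_int.
move=> E ED mE; rewrite -Radon_Nikodym_integral //.
by rewrite -[LHS]/(rho (E `&` D)) rhoE // ?setIidl //; exact: measurableI.
Qed.

End Density.

Section Mesh.
Context {R : realType}.
Variables (J : nat) (x : nat -> R).

(** The mesh is finite and its points are measurable. *)
Lemma measurable_sub_mesh (A : set (measurableTypeR R)) :
  A `<=` mesh J x -> measurable A.
Proof.
move=> Ax; apply: countable_measurable => [t|]; first exact: measurable_set1.
apply: (sub_countable (subset_card_le Ax)).
exact/finite_set_countable/finite_image/finite_II.
Qed.

Lemma measurable_fun_mesh d (T : measurableType d) (h : measurableTypeR R -> T) :
  measurable_fun (mesh J x) h.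
Proof. by move=> _ Y _; apply: measurable_sub_mesh => y []. Qed.

Lemma ge0_integral_nu (h : R -> R) : (forall y, 0 <= h y) ->
  (\int[nu J x]_(y in mesh J x) (h y)%:E =
   (J%:R^-1 * \sum_(j < J) h (x j))%:E)%E.
Proof.
move=> h_ge0; have mm : measurable (mesh J x : set (measurableTypeR R)).
  exact: measurable_sub_mesh.
have mh : measurable_fun (mesh J x) (fun y : measurableTypeR R => (h y)%:E).
  exact: measurable_fun_mesh.
rewrite /nu ge0_integral_mscale //; last by move=> y _; rewrite lee_fin.
rewrite ge0_integral_measure_sum //; last by move=> y _; rewrite lee_fin.
rewrite EFinM -sumEFin; congr (_ * _)%E; apply: eq_bigr => j _.
rewrite integral_dirac // diracE mem_set ?mul1e //.
by exists j => //=; exact: ltn_ord.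
Qed.

Lemma Rintegral_nu (h : R -> R) :
  \int[nu J x]_(y in mesh J x) h y = J%:R^-1 * \sum_(j < J) h (x j).
Proof.
pose p y := Num.max (h y) 0; pose n y := Num.max (- h y) 0.
have p_ge0 y : 0 <= p y by rewrite le_max lexx orbT.
have n_ge0 y : 0 <= n y by rewrite le_max lexx orbT.
have hE y : h y = p y - n y.
  by rewrite /p /n; case: (leP (h y) 0); case: (leP (- h y) 0); lra.
have intP (q : R -> R) : (forall y, 0 <= q y) ->
    (nu J x).-integrable (mesh J x) (fun y => (q y)%:E).
  move=> q_ge0; apply/integrableP; split; first exact: measurable_fun_mesh.
  under eq_integral do rewrite gee0_abs ?lee_fin //.
  by rewrite ge0_integral_nu // ltry.
under eq_Rintegral do rewrite hE.
rewrite RintegralB; [|exact: measurable_sub_mesh|exact: intP..].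
rewrite /Rintegral !ge0_integral_nu //= -mulrBr -sumrB.
by congr (_ * _); apply: eq_bigr => j _; rewrite -hE.
Qed.

End Mesh.

(** * The kernel, the data and the representers *)

Section PairIndex.
Variables (n0 J : nat).

Lemma pair_of_indexK (p : 'I_(n0 * J)) :
  mxvec_index (pair_of_index p).1 (pair_of_index p).2 = p.
Proof.
rewrite /mxvec_index -surjective_pairing enum_valK; exact: cast_ordKV.
Qed.

Lemma mxvec_indexK (k : 'I_n0) (j : 'I_J) :
  pair_of_index (mxvec_index k j) = (k, j).
Proof. by rewrite /pair_of_index /mxvec_index cast_ordK enum_rankK. Qed.

Lemma sum_pair_of_index (R : nmodType) (F : 'I_n0 -> 'I_J -> R) :
  \sum_k \sum_j F k j =
  \sum_(p < n0 * J) F (pair_of_index p).1 (pair_of_index p).2.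
Proof.
rewrite pair_bigA /=.
rewrite (reindex (@pair_of_index n0 J)) //=.
exists (fun kj => mxvec_index kj.1 kj.2) => [p _|[k j] _].
  exact: pair_of_indexK.
exact: mxvec_indexK.
Qed.

End PairIndex.

Section Data.
Context {R : realType}.
Variables (n0 J : nat) (x : nat -> R) (g : 'I_n0 -> R -> R -> R)
  (f : 'I_n0 -> R -> R) (rho : {measure set (measurableTypeR R) -> \bar R}).
Hypotheses (n0_gt0 : (0 < n0)%N) (J_gt0 : (0 < J)%N).
Hypothesis g_L2 : data_in_L2 J x g.
Hypothesis g_bounded : data_bounded J x g.
Hypothesis Z_gt0 : 0 < Zconst J x g.
Hypothesis rhoE : is_exploration_measure J x g rho.

Local Notation m := (n0 * J)%N.
Local Notation w := (rhodot J x g).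
Local Notation L2 := (in_L2 rho S01).
Local Notation dot := (L2_dot rho S01).
Local Notation A := (LGbar J x g rho).

Definition datum (q : 'I_m) (s : R) : R :=
  g (pair_of_index q).1 (x (pair_of_index q).2) s.

Definition normalized_datum (q : 'I_m) (s : R) : R := datum q s / w s.
Local Notation e := normalized_datum.

Let mS : measurable (S01 : set (measurableTypeR R)).
Proof. exact: measurable_itv. Qed.

Let Ngt0 : 0 < m%:R :> R. Proof. by rewrite ltr0n muln_gt0 n0_gt0. Qed.

(* the factor of rhodot in front of the sum over all data of |g| *)
Let c0 : R := (n0%:R * Zconst J x g)^-1 * J%:R^-1.
Let c0_gt0 : 0 < c0.
Proof.
have n0R : 0 < n0%:R :> R by rewrite ltr0n.
have JR : 0 < J%:R :> R by rewrite ltr0n.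
by rewrite /c0 mulr_gt0 // invr_gt0 // mulr_gt0.
Qed.

Lemma rhodotE s : w s = c0 * \sum_q `|datum q s|.
Proof.
rewrite /rhodot; under eq_bigr do rewrite Rintegral_nu.
by rewrite -mulr_sumr mulrA sum_pair_of_index.
Qed.

Lemma datum_le_rhodot q s : c0 * `|datum q s| <= w s.
Proof.
rewrite rhodotE ler_pM2l // (bigD1 q) //= lerDl.
by apply: sumr_ge0 => p _; exact: normr_ge0.
Qed.

Lemma rhodot_ge0 s : 0 <= w s.
Proof. by rewrite rhodotE mulr_ge0 ?(ltW c0_gt0) ?sumr_ge0. Qed.

(** Where rhodot vanishes, so does each datum, as it is dominated by a multiple
    of rhodot. *)
Lemma datumE q s : datum q s = e q s * w s.
Proof.
have [w0|w0] := eqVneq (w s) 0; last by rewrite divfK.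
rewrite w0 mulr0; apply/eqP; rewrite -normr_le0.
by have := datum_le_rhodot q s; rewrite w0 pmulr_rle0.
Qed.

Lemma normalized_datum_bounded q s : `|e q s| <= c0^-1.
Proof.
rewrite /e; have [->|w0] := eqVneq (w s) 0.
  by rewrite invr0 mulr0 normr0 invr_ge0 ltW.
rewrite normrM normfV (ger0_norm (rhodot_ge0 s)).
have w_gt0 : 0 < w s by rewrite lt_neqAle eq_sym w0 rhodot_ge0.
rewrite ler_pdivrMr // mulrC ler_pdivlMr // mulrC; exact: datum_le_rhodot.
Qed.

Lemma measurable_datum q : measurable_fun (S01 : set (measurableTypeR R)) (datum q).
Proof.
have [k_meas _] := g_L2 (pair_of_index q).1.
have mj : mesh J x (x (pair_of_index q).2).
  by exists (pair_of_index q).2 => //=; exact: ltn_ord.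
have mpair : measurable_fun (S01 : set (measurableTypeR R))
    (fun s : measurableTypeR R => (x (pair_of_index q).2 : measurableTypeR R, s)).
  by apply: measurable_funTS; exact: pair1_measurable.
apply: (measurable_comp _ _ k_meas mpair).
- by apply: measurableX; [exact: (@measurable_sub_mesh _ J x)|exact: mS].
- by move=> _ [s Ss <-].
Qed.

Lemma measurable_rhodot : measurable_fun (S01 : set (measurableTypeR R)) w.
Proof.
rewrite (_ : w = fun s => c0 * \sum_q `|datum q s|); last first.
  by apply/funext => s; exact: rhodotE.
apply: measurable_funM => //; apply: measurable_sum => q.
by apply: measurableT_comp => //; exact: measurable_datum.
Qed.

Lemma measurable_normalized_datum q :
  measurable_fun (S01 : set (measurableTypeR R)) (e q).
Proof.
(* measurability of the inverse comes from that of real powers *)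
rewrite (_ : e q = fun s => datum q s * (w s `^ (-1))); last first.
  by apply/funext => s; rewrite powR_inv1 // rhodot_ge0.
apply: measurable_funM; first exact: measurable_datum.
exact: (@measurableT_comp _ _ _ _ _ _ (@powR R ^~ (-1))) measurable_rhodot.
Qed.

Lemma rhodot_integrable : leb.-integrable S01 (fun s => (w s)%:E).
Proof.
have [M gM] := g_bounded.
apply: measurable_bounded_integrable => //.
- rewrite -[leb _]/(lebesgue_measure `[0%R, 1%R]%classic) lebesgue_measure_itv.
  by rewrite /= lte_fin ltr01 -EFinD ltry.
- exact: measurable_rhodot.
exists (c0 * \sum_(q < m) M); split; first exact: num_real.
move=> B MB s Ss; rewrite /= ger0_norm ?rhodot_ge0 //.
apply: le_trans (ltW MB); rewrite rhodotE ler_pM2l //.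
apply: ler_sum => q _; apply: gM => //.
by exists (pair_of_index q).2 => //=; exact: ltn_ord.
Qed.

Lemma Rintegral_rho (h : R -> R) : rho.-integrable S01 (fun s => (h s)%:E) ->
  \int[rho]_(s in S01) h s = \int[leb]_(s in S01) (h s * w s).
Proof. exact: (Rintegral_density mS rhodot_integrable rhoE). Qed.

Lemma normalized_datum_L2 q : L2 (e q).
Proof.
have me := measurable_normalized_datum q; split=> //.
apply: measurable_bounded_integrable => //.
- exact: (density_finite mS rhodot_integrable rhoE).
- by apply: measurable_funX.
exists (c0^-1 ^+ 2); split; first exact: num_real.
move=> B MB s Ss /=; apply: le_trans (ltW MB).
by rewrite normrX lerXn2r ?nnegrE ?invr_ge0 ?(ltW c0_gt0) ?normalized_datum_bounded.
Qed.

(** The indicator in Gbar is absorbed by the convention 0^-1 = 0 in the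
    normalized data. *)
Lemma GbarE s s' : Gbar J x g s s' = m%:R^-1 * \sum_q e q s * e q s'.
Proof.
rewrite /Gbar; case: ifPn => [ww|].
  have [w0 w0'] : w s != 0 /\ w s' != 0.
    by apply/andP; rewrite -negb_or -mulf_eq0 gt_eqF.
  rewrite /Gker; under eq_bigr do rewrite Rintegral_nu.
  rewrite -mulr_sumr sum_pair_of_index mulrA -invfM -natrM -mulrA mulr_suml.
  congr (_ * _); apply: eq_bigr => q _; rewrite /normalized_datum /datum.
  by field; rewrite w0 w0'.
rewrite lt_neqAle mulr_ge0 ?rhodot_ge0 // andbT negbK eq_sym => /eqP ww.
rewrite big1 ?mulr0 // => q _; rewrite /normalized_datum mulrACA -invfM ww.
by rewrite invr0 mulr0.
Qed.

Lemma LGbarE phi : L2 phi -> A phi = lincomb e (m%:R^-1 *: coefs rho S01 e phi).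
Proof.
move=> phiL; apply/funext => s; rewrite /LGbar /lincomb.
under eq_Rintegral do rewrite GbarE.
transitivity (dot (fun s' => \sum_q (m%:R^-1 * e q s) * e q s') phi).
  apply: eq_Rintegral => s' _; rewrite mulrC; congr (_ * _).
  by rewrite mulr_sumr; apply: eq_bigr => q _; rewrite mulrA.
rewrite L2_dot_suml //; last exact: normalized_datum_L2.
by apply: eq_bigr => q _; rewrite !mxE L2_dotC mulrAC.
Qed.

(** R_phi integrates phi against datum = normalized_datum * rhodot with respect
    to Lebesgue measure, which is phi against normalized_datum with respect to
    rho. *)
Lemma RphiE phi q : L2 phi ->
  Rphi g phi (pair_of_index q).1 (x (pair_of_index q).2) = dot (e q) phi.
Proof.
move=> phiL; rewrite L2_dotC /L2_dot Rintegral_rho; last first.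
  by apply: L2_integrableM => //; exact: normalized_datum_L2.
by apply: eq_Rintegral => s _; rewrite -mulrA -datumE.
Qed.

Lemma xi_index (k : 'I_n0) (j : 'I_J) : xi x g rho k j = A (e (mxvec_index k j)).
Proof. by rewrite /xi /normalized_datum /datum mxvec_indexK. Qed.

Lemma xi_integral (k : 'I_n0) (j : 'I_J) s :
  xi x g rho k j s = \int[leb]_(s' in S01) (Gbar J x g s s' * g k (x j) s').
Proof.
set q := mxvec_index k j.
have -> : g k (x j) = datum q by rewrite /datum mxvec_indexK.
rewrite xi_index -/q /LGbar Rintegral_rho.
  by apply: eq_Rintegral => s' _; rewrite datumE; ring.
apply: L2_integrableM => //; first exact: normalized_datum_L2.
rewrite (_ : Gbar J x g s = fun s' => \sum_q (m%:R^-1 * e q s) * e q s').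
  by apply: in_L2_sum => // p; exact: normalized_datum_L2.
apply/funext => s'; rewrite GbarE mulr_sumr.
by apply: eq_bigr => p _; rewrite mulrA.
Qed.

Let N1_gt0 : 0 < m%:R^-1 :> R. Proof. by rewrite invr_gt0. Qed.
Let A_sqrt := finite_rank_sqrt mS normalized_datum_L2 N1_gt0 LGbarE.
Let A_split := finite_rank_split mS normalized_datum_L2 N1_gt0 LGbarE.
Let A_L2 := finite_rank_L2 mS normalized_datum_L2 LGbarE.

Local Notation H := (HG J x g rho : set (R -> R^o)).
Local Notation hdot := (HG_dot J x g rho).

Lemma HG_semi_inner_product : semi_inner_product H hdot.
Proof.
split.
- exact: (range_0 A_sqrt).
- by move=> a u v Hu Hv; exact: (range_lin mS A_sqrt).
- by move=> u v; exact: range_dotC.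
- by move=> a u v h Hu Hv Hh; exact: (range_dot_lin mS A_sqrt A_split).
- by move=> u _; exact: range_dot_ge0.
Qed.

Lemma HG_dot_definite phi psi : H phi -> H psi ->
  hdot (fun s => phi s - psi s) (fun s => phi s - psi s) = 0 ->
  ae_eq rho S01 phi psi.
Proof.
move=> Hphi Hpsi d0; apply: ae_eq_subr0.
apply: (range_dot_eq0 mS A_sqrt A_split) d0.
exact: (sip_domainB HG_semi_inner_product Hphi Hpsi).
Qed.

Lemma xi_HG (k : 'I_n0) (j : 'I_J) : H (xi x g rho k j).
Proof.
rewrite xi_index; apply: (range_image A_sqrt); first exact: normalized_datum_L2.
by apply: A_L2; exact: normalized_datum_L2.
Qed.

Lemma xi_reproducing (k : 'I_n0) (j : 'I_J) phi : H phi ->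
  hdot (xi x g rho k j) phi = Rphi g phi k (x j).
Proof.
move=> Hphi; rewrite xi_index; set q := mxvec_index k j.
have eL := normalized_datum_L2 q.
rewrite /HG_dot (range_dot_image mS A_sqrt A_split eL (A_L2 eL) Hphi).
rewrite -RphiE; last by case: Hphi.
by rewrite /q mxvec_indexK.
Qed.

Definition representer (q : 'I_m) : R -> R^o :=
  xi x g rho (pair_of_index q).1 (pair_of_index q).2.

Lemma SigmaE : Sigma J x g rho = gram hdot representer.
Proof. by apply/matrixP => p q; rewrite !mxE. Qed.

Lemma xi_combE c : xi_comb x g rho c = combination representer c.
Proof.
apply/funext => s; rewrite /xi_comb sum_pair_of_index /combination fct_sumE.
by apply: eq_bigr => q _; rewrite pair_of_indexK.
Qed.

Lemma lossE phi : H phi -> loss J x g f phi =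
  m%:R^-1 * norm2sq (samples hdot representer phi - fvec J x f).
Proof.
move=> Hphi; rewrite /loss sum_pair_of_index natrM invfM -mulrA; congr (_ * _).
rewrite mulrC /norm2sq mulr_suml; apply: eq_bigr => q _; congr (_ * _).
by rewrite !mxE real_normK ?num_real // xi_reproducing.
Qed.

Lemma Sigma_sym : (Sigma J x g rho)^T = Sigma J x g rho.
Proof. by rewrite SigmaE; exact: (gram_sym HG_semi_inner_product). Qed.

End Data.

(** * The representation theorem *)

Theorem theorem2p5 (R : realType) (n0 J : nat) (x : nat -> R)
    (g : 'I_n0 -> R -> R -> R) (f : 'I_n0 -> R -> R)
    (rho : {measure set (measurableTypeR R) -> \bar R})
    (n0_gt0 : (0 < n0)%N) (J_gt0 : (0 < J)%N)
    (x_mesh : uniform_mesh J x)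
    (g_L2 : data_in_L2 J x g)
    (g_bounded : data_bounded J x g)
    (Z_gt0 : 0 < Zconst J x g)
    (rhoE : is_exploration_measure J x g rho) :
  [/\ forall (k : 'I_n0) (j : 'I_J) (s : R), S01 s ->
        xi x g rho k j s
        = \int[leb]_(s' in S01) (Gbar J x g s s' * g k (x j) s'),
      forall (k : 'I_n0) (j : 'I_J),
        HG J x g rho (xi x g rho k j) /\
        forall phi, HG J x g rho phi ->
          HG_dot J x g rho (xi x g rho k j) phi = Rphi g phi k (x j),
      let c := pseudoinverse (Sigma J x g rho) *m fvec J x f in
      unique_argmin rho S01
        (argmin (HG J x g rho) (loss J x g f)) (HG_normsq J x g rho)
        (xi_comb x g rho c) /\
      argmin (argmin setT (vec_loss x g f rho)) (@norm2sq R (n0 * J)) = [set c]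
    & forall lambda : R, 0 < lambda ->
      let c := pseudoinverse (Sigma J x g rho *m Sigma J x g rho
                              + ((n0 * J)%:R * lambda) *: Sigma J x g rho)
               *m (Sigma J x g rho *m fvec J x f) in
      unique_argmin rho S01
        (HG J x g rho) (regularized_loss J x g f rho lambda)
        (xi_comb x g rho c) /\
      argmin setT (regularized_vec_loss x g f rho lambda) c].
Proof.
have HP := HG_semi_inner_product n0_gt0 J_gt0 g_L2 g_bounded Z_gt0 rhoE.
have Hxi q := xi_HG n0_gt0 J_gt0 g_L2 g_bounded Z_gt0 rhoE
  (pair_of_index q).1 (pair_of_index q).2.
have uniq phi psi := HG_dot_definite n0_gt0 J_gt0 g_L2 g_bounded Z_gt0 rhoE
  (phi := phi) (psi := psi).
have lE phi := lossE f n0_gt0 J_gt0 g_L2 g_bounded Z_gt0 rhoE (phi := phi).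
have N_gt0 : 0 < (n0 * J)%:R :> R by rewrite ltr0n muln_gt0 n0_gt0.
have N1_gt0 : 0 < (n0 * J)%:R^-1 :> R by rewrite invr_gt0.
have Ssym := Sigma_sym n0_gt0 J_gt0 g_L2 g_bounded Z_gt0 rhoE.
split.
- by move=> k j s _; exact: xi_integral.
- by move=> k j; split=> [|phi]; [exact: xi_HG|exact: xi_reproducing].
- move=> c; split; last exact: pseudoinverse_least_squares.
  have Sc := pseudoinverse_normal_equation (Sigma J x g rho) (fvec J x f).
  rewrite Ssym -/c SigmaE in Sc.
  rewrite xi_combE /c SigmaE.
  have [cmin cuniq] := min_norm_least_squares HP Hxi N1_gt0 lE
    (fun=> erefl) Sc.
  by split=> // phi /cuniq[Hphi]; exact: uniq _ _ Hphi cmin.1.1.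
move=> lambda l_gt0 c; set b := (n0 * J)%:R * lambda in c *.
have b_gt0 : 0 < b by exact: mulr_gt0.
have Sc : gram (HG_dot J x g rho) (representer x g rho) *m
    (gram (HG_dot J x g rho) (representer x g rho) *m c - fvec J x f + b *: c) = 0.
  rewrite -SigmaE; apply: tikhonov_normal_equation => //.
  by move=> v; rewrite SigmaE; exact: (gram_psd HP Hxi).
have rE phi : HG J x g rho phi -> regularized_loss J x g f rho lambda phi =
    (n0 * J)%:R^-1 *
      norm2sq (samples (HG_dot J x g rho) (representer x g rho) phi - fvec J x f)
    + ((n0 * J)%:R^-1 * b) * HG_dot J x g rho phi phi.
  by move=> Hphi; rewrite /regularized_loss lE // /b mulKf ?gt_eqF.
have [[Hc cmin] cuniq] := tikhonov_minimizer HP Hxi N1_gt0 b_gt0 rE Sc.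
split.
  rewrite xi_combE; split=> // phi /cuniq[Hphi]; exact: uniq _ _ Hphi Hc.
have vE (d : 'cV[R]_(n0 * J)) : regularized_vec_loss x g f rho lambda d =
    regularized_loss J x g f rho lambda (combination (representer x g rho) d).
  rewrite rE; last exact: (combination_domain HP Hxi d).
  rewrite /regularized_vec_loss /vec_loss SigmaE.
  rewrite (gram_quadratic HP Hxi) (samples_combination HP Hxi).
  by rewrite /b mulKf ?gt_eqF.
split=> // d _; rewrite !vE; apply: cmin; exact: (combination_domain HP Hxi d).
Qed.
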